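(* There exist an absolute constant $c>0$, a sequence of weights $w_j\in A_1^d$ with $[w_j]^d_{A_1}\to\infty$ as $j\to\infty$, and martingale transforms $T_j$ such that for every $j$ $$\|T_j: L^1(w_j)\to L^{1,\infty}(w_j)\|\ \ge\ c\,[w_j]^d_{A_1}\,\log [w_j]^d_{A_1}.$$
   Context: Everything lives on $I_0=[0,1)$; $\mathcal D$ is the family of dyadic subintervals of $I_0$ (including $I_0$), and $\langle f\rangle_J=\frac1{|J|}\int_J f\,dx$. A weight is an a.e. positive integrable function on $I_0$; a weight $w$ is identified with the measure $w\,dx$. For a weight $w$, $[w]^d_{A_1}=\sup_{J\in\mathcal D}\langle w\rangle_J\,(\operatorname{ess\,inf}_J w)^{-1}$, and $w\in A_1^d$ means $[w]^d_{A_1}<\infty$. For $I\in\mathcal D$, $h_I$ is the $L^2(dx)$-normalized Haar function of $I$ (equal to $\pm|I|^{-1/2}$ on the two halves of $I$, zero outside $I$), and $(f,h_I)=\int f h_I\,dx$. A martingale transform is an operator $Tf=\sum_{I\in\mathcal D}\varepsilon_I (f,h_I)h_I$ with real coefficients $|\varepsilon_I|\le 1$. The norm $\|T:L^1(w)\to L^{1,\infty}(w)\|$ is the smallest constant $N$ such that $\alpha\, w\{x\in I_0: |Tf(x)|>\alpha\}\le N\int_{I_0}|f|\,w\,dx$ for all $\alpha>0$ and all $f\in L^1(w)$. *)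

(* Defs.v *)
From HB Require Import structures.
From mathcomp Require Import all_boot all_order all_algebra.
From mathcomp Require Import all_classical all_reals all_analysis.
From mathcomp Require Import ess_sup_inf.
Set Implicit Arguments.
Unset Strict Implicit.
Unset Printing Implicit Defensive.
Import Order.TTheory GRing.Theory Num.Theory.
Import numFieldNormedType.Exports.
Local Open Scope classical_set_scope.
Local Open Scope ring_scope.

Section definitions.
Context {R : realType}.
Local Notation mu := (@lebesgue_measure R).
Implicit Types (w f : R -> R) (n k : nat).

(* Functions on [0, 1) are total functions R -> R: their values outside [0, 1)
   are never used. *)
Definition I0 : set R := `[0, 1[.

(* The dyadic subintervals of I0 are the [dyadic n k] with k < 2 ^ n;
   [dyadic n k] has length 2 ^- n, and its left and right halves are
   [dyadic n.+1 k.*2] and [dyadic n.+1 k.*2.+1]. *)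
Definition dyadic n k : set R := `[k%:R / 2 ^+ n, k.+1%:R / 2 ^+ n[.

Definition Dyadic : set (set R) :=
  [set J | exists n k, (k < 2 ^ n)%N /\ J = dyadic n k].

Lemma measurable_dyadic n k : measurable (dyadic n k).
Proof. exact: measurable_itv. Qed.

Lemma Dyadic_measurable (J : set R) : Dyadic J -> measurable J.
Proof. by move=> [n [k [_ ->]]]; exact: measurable_dyadic. Qed.

Definition weight w : Prop :=
  mu.-integrable I0 (EFin \o w) /\ {ae mu, forall x, I0 x -> 0 < w x}.

Definition wmeasure w (A : set R) : \bar R := (\int[mu]_(x in A) (w x)%:E)%E.

Definition average w (J : set R) : \bar R :=
  ((\int[mu]_(x in J) (w x)%:E) / mu J)%E.

Definition ess_inf_on (J : set R) (mJ : measurable J) w : \bar R :=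
  ess_inf (mrestr mu mJ) (EFin \o w).

(* The inverse is that of \bar R, for which 0^-1 = +oo. *)
Definition A1_char w : \bar R :=
  ereal_sup [set y | exists (J : set R) (DJ : Dyadic J),
    y = (average w J * (ess_inf_on (Dyadic_measurable DJ) w)^-1)%E].

Definition A1 w : Prop := weight w /\ (A1_char w < +oo)%E.

Definition haar n k (x : R) : R :=
  (Num.sqrt (2 ^- n))^-1 *
  (\1_(dyadic n.+1 k.*2.+1) x - \1_(dyadic n.+1 k.*2) x).

Definition haar_coef f n k : R := (\int[mu]_(x in I0) (f x * haar n k x))%R.

(* The series over all dyadic intervals is summed pointwise, generation by
   generation; for f in L^1(dx) it converges at almost every point of I0. *)
Definition haar_multiplier (eps : forall n, 'I_(2 ^ n) -> R) f (x : R) : R :=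
  limn (fun N => \sum_(n < N) \sum_(k < 2 ^ n)
    eps n k * haar_coef f n k * haar n k x).

Definition martingale_transform (T : (R -> R) -> (R -> R)) : Prop :=
  exists2 eps : forall n, 'I_(2 ^ n) -> R,
    (forall n (k : 'I_(2 ^ n)), `|eps n k| <= 1) & T = haar_multiplier eps.

Definition L1 w f : Prop :=
  measurable_fun I0 f /\ (\int[mu]_(x in I0) (`|f x| * w x)%:E < +oo)%E.

Definition weak_type_bound w (T : (R -> R) -> (R -> R)) (N : R) : Prop :=
  forall (alpha : R) f, 0 < alpha -> L1 w f ->
    (alpha%:E * wmeasure w [set x | I0 x /\ (alpha < `|T f x|)%R] <=
     N%:E * \int[mu]_(x in I0) (`|f x| * w x)%:E)%E.

(* Equal to +oo when no finite constant is admissible. *)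
Definition weak_norm w (T : (R -> R) -> (R -> R)) : \bar R :=
  ereal_inf [set N%:E | N in weak_type_bound w T].

End definitions.

(* Main.v *)
Require Import Defs.
From mathcomp Require Import all_boot all_order all_algebra.
From mathcomp Require Import all_classical all_reals all_analysis.
From mathcomp Require Import ess_sup_inf measurable_realfun ring lra.
Import Order.TTheory GRing.Theory Num.Theory.
Import numFieldNormedType.Exports.
Local Open Scope classical_set_scope.
Local Open Scope ring_scope.
Set Implicit Arguments.
Unset Strict Implicit.
Unset Printing Implicit Defensive.

(* Play a truncated St. Petersburg game. Put t = 4^M. An interval J of generation k
   contains next-generation intervals J_i, 1 <= i <= M, with |J_i| = 4^-i |J|; on the
   rest of J the weight is 3^k / t, and after n = t / 2 generations it is 3^n. Since
   3 (4^-1 + ... + 4^-M) = 1 - 1/t, the weight has average comparable to 3^k on J, so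
   its A_1 constant is comparable to t, and at least half of its mass lies in the last
   generation. The function f is 1 on a set of relative length 1/t in each J of each
   generation but the last, compensated so as to have mean 0 on J; its weighted norm
   is at most 1/t. With a proper choice of signs, passing from J to J_i increases T f
   by about 4^i / (3 t), and this has probability about 3 * 4^-i under the weight. All
   M scales contribute equally to the mean gain, which is at least M / t, while the
   second moment is only O(1/t). By Chebyshev, T f is at least M / 4 on a quarter of
   the mass, and the weak norm is at least M t / 16, i.e. of order t log t. *)

(** * Dyadic trees *)

(* A tree encodes the functions on [0, 1) that are constant on each of its leaves,
   a node being split into its two dyadic halves. The scalar at a node is the
   coefficient of the martingale transform on that interval. *)
Inductive tree (R A : Type) : Type :=
| Leaf of A
| Node of R & tree R A & tree R A.
Arguments Leaf {R A}.

Section tree_algebra.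
Context {R : realFieldType} {A : Type}.
Implicit Types (s : tree R A) (h : A -> R).

Fixpoint avg h s : R :=
  match s with Leaf a => h a | Node _ l r => (avg h l + avg h r) / 2 end.

Definition sign s : R := if s is Node e _ _ then e else 0.

Definition child (right : bool) s :=
  match s with Leaf a => Leaf a | Node _ l r => if right then r else l end.

Fixpoint depth s : nat :=
  if s is Node _ l r then (maxn (depth l) (depth r)).+1 else 0.

Fixpoint all_subtrees (P : tree R A -> Prop) s : Prop :=
  P s /\ if s is Node _ l r then all_subtrees P l /\ all_subtrees P r else True.

Fixpoint all_leaves (P : A -> Prop) s : Prop :=
  match s with
  | Leaf a => P a
  | Node _ l r => all_leaves P l /\ all_leaves P r
  end.

(* Pairs each leaf with the value that the martingale transform of [h], increased
   by [c], takes on it. *)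
Fixpoint transform h (c : R) s : tree R (A * R) :=
  match s with
  | Leaf a => Leaf (a, c)
  | Node e l r =>
      let d := e * ((avg h r - avg h l) / 2) in
      Node e (transform h (c - d) l) (transform h (c + d) r)
  end.

Lemma all_subtreesW (P : tree R A -> Prop) s : all_subtrees P s -> P s.
Proof. by case: s => [a|e l r] []. Qed.

Lemma all_subtrees_child (P : tree R A -> Prop) b s :
  all_subtrees P s -> all_subtrees P (child b s).
Proof. by case: s => [a|e l r] //= [_ []]; case: b. Qed.

Lemma all_leaves_impl (P Q : A -> Prop) s : (forall a, P a -> Q a) ->
  all_leaves P s -> all_leaves Q s.
Proof. by move=> PQ; elim: s => [a|e l ihl r ihr] /=; [auto|case; auto]. Qed.

End tree_algebra.

Lemma avg_transform (R : realFieldType) (A : Type) (g h : A -> R) c (s : tree R A) :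
  avg (fun l => h l.1) (transform g c s) = avg h s.
Proof. by elim: s c => //= e l ihl r ihr c; rewrite ihl ihr. Qed.

Lemma bernoulli_inequality (R : realFieldType) (x : R) n : 0 <= x <= 1 ->
  1 - n%:R * x <= (1 - x) ^+ n.
Proof.
move=> /andP[x0 x1]; elim: n => [|n ih]; first by rewrite mul0r subr0 expr0.
rewrite exprS; apply: (@le_trans _ _ ((1 - x) * (1 - n%:R * x))).
  have : 0 <= n%:R * x * x by rewrite !mulr_ge0.
  by rewrite -natr1; nra.
by rewrite ler_wpM2l// subr_ge0.
Qed.

(** * The extremal tree *)

Section construction.
Context {R : realFieldType} (M : nat).
Implicit Types (lam z c y kappa B a : R) (G : tree R (R * R)) (r j : nat).

Local Notation t := (4 ^+ M : R).

(* Leaves carry the pair (weight, function). The interval of [chain _ _ _ j] shrinks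
   to its left quarter at each step; the copies of [G] sit at the second quarters,
   and the transform acts only where such a copy splits off. *)
Fixpoint chain lam z G j : tree R (R * R) :=
  if j is j'.+1 then
    Node 0 (Node (-1) (chain lam 0 G j') G) (Leaf (lam / t, z))
  else Leaf (lam / t, 1).

(* The value [- 2 / 4 ^ M] at the first discarded half makes the function have mean
   zero on each generation, so that only the inside of the chains moves [T f]. *)
Fixpoint gen r lam : tree R (R * R) :=
  if r is r'.+1 then chain lam (- 2 / t) (gen r' (3 * lam)) M
  else Leaf (lam, 0).

Lemma pow4_gt0 : 0 < t. Proof. by rewrite exprn_gt0. Qed.

Lemma pow4_ge1 : 1 <= t. Proof. by rewrite exprn_ege1// ?ler1n. Qed.

Lemma avg_snd_chain lam z G j : avg snd G = 0 ->
  avg snd (chain lam z G j) = 4 ^- j + (if j is 0 then 0 else z / 2).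
Proof.
move=> G0; elim: j z => [|j ih] z /=; first by rewrite expr0 invr1 addr0.
have p0 : (4 ^+ j : R) != 0 by rewrite expf_neq0// pnatr_eq0.
rewrite ih G0 exprS; have -> : (if j is 0 then 0 else 0 / 2) = 0 :> R.
  by case: j {ih p0} => //; rewrite mul0r.
by field.
Qed.

Lemma avg_snd_gen r lam : (0 < M)%N -> avg snd (gen r lam) = 0.
Proof.
move=> M0; elim: r lam => [//|r ih] lam /=.
have p0 : (4 ^+ M : R) != 0 by rewrite expf_neq0// pnatr_eq0.
by rewrite avg_snd_chain//; case: M M0 p0 => // m _ p0; field.
Qed.

(* Moments of orders 0, 1, 2 of the gain X_i = 4^-j (4^i + 2) / 3 made when leaving
   [chain _ _ _ j] through its copy of [G] of relative length 4^-i, 1 <= i <= j. *)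
Definition mom0 j : R := (1 - 4 ^- j) / 3.
Definition mom1 j : R := 4 ^- j / 3 * (j%:R + 2 * mom0 j).
Definition mom2 j : R :=
  (4 ^- j) ^+ 2 / 9 * ((4 ^+ j * 4 - 4) / 3 + 4 * j%:R + 4 * mom0 j).

(** * Distribution of the transform under the weight *)

Section weak_type.
Variable phi : R -> R.
Hypothesis phi_ge0 : forall a, 0 <= phi a.

Let h (l : (R * R) * R) := l.1.1 * phi l.2.

(** The sum over [i] of the bound on the copy of [G] of relative length [4^-i], taken at [c + X_i].
    The remaining leaves contribute nonnegative amounts, since [phi] and [lam] are nonnegative. *)
Lemma avg_transform_chain lam z G j kappa K y B c :
  0 <= lam -> avg snd G = 0 ->
  (forall a, K * (1 - kappa * ((a - y) ^+ 2 + B)) <= avg h (transform snd a G)) ->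
  K * (mom0 j - kappa * (mom0 j * (c - y) ^+ 2 + 2 * mom1 j * (c - y) +
                         mom2 j + B * mom0 j))
  <= avg h (transform snd c (chain lam z G j)).
Proof.
move=> lam0 G0 hG.
have h0 a b : 0 <= h ((lam / t, a), b).
  by rewrite /h /= mulr_ge0// divr_ge0// ltW// pow4_gt0.
elim: j z c => [|j ih] z c /=.
  rewrite /mom2 /mom1 /mom0 expr0 invr1 subrr !(mul0r, mulr0, mul1r, mulr1, addr0, subrr).
  exact: h0.
rewrite mul0r subr0 addr0 G0 avg_snd_chain//.
have -> : (if j is 0 then 0 else 0 / 2) = 0 :> R by case: j {ih} => //; rewrite mul0r.
rewrite addr0 sub0r.
have := ih 0 (c - -1 * (- (4 ^- j) / 2)); have := hG (c + -1 * (- (4 ^- j) / 2)).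
have := h0 z c; set x := avg _ _; set x' := avg _ _; set x'' := h _.
move=> H1 H2 H3.
(* One step moves the value by [4^-j / 2], up on the copy of [G] and down along the chain, each on a
   quarter of the interval. *)
suff -> : K * (mom0 j.+1 - kappa * (mom0 j.+1 * (c - y) ^+ 2 +
   2 * mom1 j.+1 * (c - y) + mom2 j.+1 + B * mom0 j.+1)) =
   (K * (1 - kappa * ((c + -1 * (- (4 ^- j) / 2) - y) ^+ 2 + B)) +
    K * (mom0 j - kappa * (mom0 j * (c - -1 * (- (4 ^- j) / 2) - y) ^+ 2 +
      2 * mom1 j * (c - -1 * (- (4 ^- j) / 2) - y) +
                         mom2 j + B * mom0 j))) / 4 by lra.
have p0 : (4 ^+ j : R) != 0 by rewrite expf_neq0// pnatr_eq0.
rewrite /mom2 /mom1 /mom0 exprS -(natr1 j).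
by field.
Qed.

(** As [mom0 M] is the total relative length of the copies, dividing by it conditions on leaving the
    chain through a copy. *)
Definition gain_mean : R := mom1 M / mom0 M.
Definition gain_variance : R := mom2 M / mom0 M - gain_mean ^+ 2.

(* Chebyshev: the gains of successive generations are independent under the weight,
   [phi] is to be the indicator of a set containing a neighbourhood of the mean,
   and the parabola [1 - kappa (a - y)^2] below it has an exactly computable integral. *)
Lemma avg_transform_gen r lam kappa y c : (0 < M)%N -> 0 <= lam ->
  (forall a, 1 - kappa * (a - y) ^+ 2 <= phi a) ->
  lam * (3 * mom0 M) ^+ r *
    (1 - kappa * ((c + r%:R * gain_mean - y) ^+ 2 + r%:R * gain_variance))
  <= avg h (transform snd c (gen r lam)).
Proof.
move=> M0 + hphi; elim: r lam c => [|r ih] lam c lam0 /=.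
  rewrite expr0 !mul0r !addr0 mulr1 /h/=; exact: ler_wpM2l.
have m0 : mom0 M != 0.
  rewrite /mom0; apply/eqP => m0.
  have : 4 ^- M = 1 :> R by lra.
  move/eqP; rewrite invr_eq1 => /eqP; case: M M0 => // m _ H.
  by have : 1 < 4 ^+ m.+1 :> R by [rewrite exprn_egt1// ltr1n]; rewrite H ltxx.
have lam30 : 0 <= 3 * lam by rewrite mulr_ge0.
(* Used with [y - r * gain_mean] for [y] and [r * gain_variance] for [B]. *)
apply: le_trans (avg_transform_chain _ _ _ _ (avg_snd_gen _ _ _) _) => //.
  2: move=> a.
  2: have := ih (3 * lam) a lam30.
  2: by rewrite -[a + _ - y]addrA -[_ * gain_mean - y]opprB; apply.
(* Completing the square turns the moments into one more mean and one more variance. *)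
rewrite le_eqVlt; apply/orP; left; apply/eqP.
rewrite exprS -(natr1 r) /gain_variance /gain_mean.
by field.
Qed.

End weak_type.

(** * Total mass and weighted norm of the function *)

Lemma avg_fst_chain lam z G j V : 0 <= lam -> 0 <= V -> avg fst G <= V ->
  avg fst (chain lam z G j) <= V / 3 + lam / t.
Proof.
move=> lam0 V0 GV; have t0 := pow4_gt0.
have lt0 : 0 <= lam / t by rewrite divr_ge0// ltW.
elim: j z => [|j ih] z /=; first by lra.
by have := ih 0; lra.
Qed.

Lemma avg_fst_gen r lam : 0 <= lam ->
  avg fst (gen r lam) <= lam * (1 + r%:R / t).
Proof.
elim: r lam => [|r ih] lam lam0 /=; first by rewrite mul0r addr0 mulr1.
have l3 : 0 <= 3 * lam by rewrite mulr_ge0.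
apply: le_trans (avg_fst_chain _ _ _ _ (ih _ l3)) _ => //.
  by rewrite mulr_ge0// addr_ge0// divr_ge0// ltW// pow4_gt0.
by rewrite -(natr1 r); lra.
Qed.

Lemma avg_cost_chain lam z G j V : 0 <= lam ->
  avg (fun a : R * R => `|a.2| * a.1) G <= V ->
  avg (fun a : R * R => `|a.2| * a.1) (chain lam z G j) <=
    V / 3 * (1 - 4 ^- j) + 4 ^- j * (lam / t) + `|z| / 2 * (lam / t).
Proof.
move=> lam0 GV; have t0 := pow4_gt0.
have lt0 : 0 <= lam / t by rewrite divr_ge0// ltW.
elim: j z => [|j ih] z /=.
  rewrite expr0 normr1 invr1.
  have : 0 <= `|z| / 2 * (lam / t) by rewrite mulr_ge0// divr_ge0.
  lra.
have := ih 0; rewrite normr0 exprS invfM; set p := 4 ^- j.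
lra.
Qed.

(** A generation costs at most [lam / t ^+ 2] at the end of its chain and as much on the first
    discarded half. The cost of deeper generations is tripled by the scale but sits on less than a
    third of the interval. *)
Lemma avg_cost_gen r lam : 0 <= lam ->
  avg (fun a : R * R => `|a.2| * a.1) (gen r lam) <= 2 * r%:R * lam / t ^+ 2.
Proof.
elim: r lam => [|r ih] lam lam0 /=; first by rewrite normr0 !(mulr0, mul0r).
have l3 : 0 <= 3 * lam by rewrite mulr_ge0.
have t0 := pow4_gt0.
apply: le_trans (avg_cost_chain _ _ _ (ih _ l3)) _ => //.
rewrite normrM normrN normfV (gtr0_norm t0) (gtr0_norm (ltr0n _ 2)) -(natr1 r).
have : 0 <= 2 * r%:R * (3 * lam) / t ^+ 2 / 3 * t^-1.
  have ? : 0 <= r%:R :> R by [].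
  have ? : 0 <= t by exact: ltW.
  by rewrite !(divr_ge0, mulr_ge0, exprn_ge0).
have -> : 2 / t / 2 * (lam / t) = lam / t ^+ 2 by field; rewrite gt_eqF.
have -> : t^-1 * (lam / t) = lam / t ^+ 2 by field; rewrite gt_eqF.
lra.
Qed.

(** * Lower bounds for the weight and the A_1 condition on the tree *)

Lemma all_leaves_chain (P : R * R -> Prop) lam z G j :
  P (lam / t, 1) -> P (lam / t, 0) -> P (lam / t, z) -> all_leaves P G ->
  all_leaves P (chain lam z G j).
Proof.
by move=> P1 P0 + PG; elim: j z => [|j ih] z Pz //=; do !split => //; exact: ih.
Qed.

Lemma all_leaves_gen r lam : 0 <= lam ->
  all_leaves (fun a : R * R => lam / t <= a.1) (gen r lam).
Proof.
elim: r lam => [|r ih] lam lam0 /=.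
  by rewrite ler_pdivrMr ?pow4_gt0// ler_peMr// pow4_ge1.
apply: all_leaves_chain => //=.
have l3 : 0 <= 3 * lam by rewrite mulr_ge0.
apply: all_leaves_impl (ih _ l3) => a; apply: le_trans.
by rewrite ler_pM2r ?invr_gt0 ?pow4_gt0// ler_peMl// ?ler1n.
Qed.

(** A lower bound [m] replaces the essential infimum. Nodes suffice, the weight being constant on
    dyadic intervals inside a leaf. *)
Definition A1_node K (s : tree R (R * R)) : Prop := exists m,
  [/\ 0 < m, all_leaves (fun a : R * R => m <= a.1) s & avg fst s <= K * m].

Lemma A1_leaf K (a : R * R) : 1 <= K -> 0 < a.1 -> A1_node K (Leaf a).
Proof. by move=> K1 a0; exists a.1; split => //=; rewrite ler_peMl// ltW. Qed.

(** In one generation the weight is at least [lam / t], while [r <= t] bounds the averages by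
    [6 * lam] on copies of the next generation and by [3 * lam] on chains. *)
Lemma A1_gen r lam : (r%:R <= t) -> 0 < lam ->
  all_subtrees (A1_node (6 * t)) (gen r lam).
Proof.
have t0 := pow4_gt0; have t1 := pow4_ge1.
have t6 : 1 <= 6 * t by lra.
elim: r lam => [|r ih] lam rt lam0; first by split => //; exact: A1_leaf.
have l3 : 0 < 3 * lam by rewrite mulr_gt0.
have rt' : r%:R <= t by apply: le_trans rt; rewrite ler_nat.
have {ih} := ih (3 * lam) rt' l3.
have lt0 : 0 < lam / t by rewrite divr_gt0.
have ltl : lam / t <= lam by rewrite ler_pdivrMr// ler_peMr// ltW.
have : avg fst (gen r (3 * lam)) <= 6 * lam.
  apply: le_trans (avg_fst_gen _ (ltW l3)) _.
  have : r%:R / t <= 1 by rewrite ler_pdivrMr// mul1r.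
  by nra.
have : all_leaves (fun a : R * R => lam / t <= a.1) (gen r (3 * lam)).
  apply: all_leaves_impl (all_leaves_gen r (ltW l3)) => a; apply: le_trans.
  by rewrite ler_pM2r ?invr_gt0//; lra.
rewrite [gen r.+1 _]/=; set G := gen r _; move: (- 2 / t) => z lG GV aG.
have Kl : 6 * t * (lam / t) = 6 * lam by field; rewrite gt_eqF.
have avg_le j y : avg fst (chain lam y G j) <= 3 * lam.
  have l6 : 0 <= 6 * lam by lra.
  by apply: le_trans (avg_fst_chain _ _ (ltW lam0) l6 GV) _; lra.
have lC y j : all_leaves (fun a : R * R => lam / t <= a.1) (chain lam y G j).
  by apply: all_leaves_chain.
suff H j y : all_subtrees (A1_node (6 * t)) (chain lam y G j) by exact: H.
elim: j y => [|j ih] y; first by split => //; exact: A1_leaf.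
have ? := avg_le j 0.
have ? := avg_le j.+1 y.
split; [exists (lam / t); split => //; first exact: (lC _ j.+1); lra|split].
  split; [exists (lam / t); split => //|split => //; exact: ih].
  by rewrite Kl /=; lra.
by split => //; exact: A1_leaf.
Qed.

Lemma sign_gen r lam :
  all_subtrees (fun s => `|sign s| <= 1) (gen r lam).
Proof.
elim: r lam => [|r ih] lam /=; first by rewrite normr0.
move: (gen r _) (ih (3 * lam)) (- 2 / t) => G hG.
move=> z.
suff H j y :
    all_subtrees (fun s : tree R (R * R) => `|sign s| <= 1) (chain lam y G j).
  exact: H.
elim: j y => [|j ih'] y /=; first by rewrite normr0.
by rewrite normrN normr1 normr0; do !split => //; exact: ih'.
Qed.

End construction.

(** * From trees to functions on the unit interval *)

Section dyadic_intervals.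
Context {R : realType}.
Implicit Types (n k : nat) (x : R).
Local Notation mu := (@lebesgue_measure R).

Lemma I0E : I0 = dyadic 0 0 :> set R.
Proof. by rewrite /I0 /dyadic expr0 !divr1. Qed.

Lemma dyadicP n k x : dyadic n k x <-> k%:R <= x * 2 ^+ n < k.+1%:R.
Proof.
rewrite /dyadic /= in_itv /= ler_pdivrMr ?exprn_gt0// ltr_pdivlMr ?exprn_gt0//.
Qed.

Lemma dyadic_half n k (b : bool) : dyadic n.+1 (b + k.*2) `<=` (dyadic n k : set R).
Proof.
move=> x /dyadicP; rewrite exprS => H; apply/dyadicP.
move: H; rewrite -(natr1 (b + k.*2)) natrD -muln2 natrM -(natr1 k).
by case: b => /= /andP[? ?]; apply/andP; split; lra.
Qed.

Lemma dyadic_parent n k : dyadic n.+1 k `<=` (dyadic n k./2 : set R).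
Proof. by rewrite -{1}(odd_double_half k); exact: dyadic_half. Qed.

Lemma dyadic_inj n k k' x : dyadic n k x -> dyadic n k' x -> k = k'.
Proof.
move=> /dyadicP/andP[k1 k2] /dyadicP/andP[k1' k2']; apply/eqP.
rewrite eqn_leq -!(ltnS _ k) -!(ltnS _ k') -!(ltr_nat R).
by rewrite (le_lt_trans k1)// (le_lt_trans k1').
Qed.

Lemma dyadic_split n k :
  dyadic n k = dyadic n.+1 k.*2 `|` dyadic n.+1 k.*2.+1 :> set R.
Proof.
apply/seteqP; split=> [x /dyadicP H|x []]; last 2 first.
- exact: (@dyadic_half n k false).
- exact: (@dyadic_half n k true).
have [xk|xk] := ltP (x * 2 ^+ n.+1) k.*2.+1%:R; [left|right]; apply/dyadicP;
  move: H xk; rewrite -?(natr1 k.*2.+1) -!(natr1 k.*2) -(natr1 k);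
  rewrite -muln2 natrM exprS => /andP[? ?] ?; apply/andP; split; lra.
Qed.

Lemma dyadic_disj n k : [disjoint dyadic n.+1 k.*2 & (dyadic n.+1 k.*2.+1 : set R)].
Proof.
apply/disj_setPS => x [xl xr].
by have /eqP := dyadic_inj xl xr; rewrite -{1}[k.*2]addn0 -addn1 eqn_add2l.
Qed.

Lemma dyadic_cover n x : I0 x -> exists2 k, (k < 2 ^ n)%N & dyadic n k x.
Proof.
move=> x0; elim: n => [|n [k kn]]; first by exists 0%N => //; rewrite -I0E.
rewrite dyadic_split => -[xk|xk]; [exists k.*2 | exists k.*2.+1] => //.
  by rewrite expnS mul2n ltn_double.
  by rewrite expnS mul2n -doubleS leq_double.
Qed.

Lemma dyadic_sub_I0 n k : (k < 2 ^ n)%N -> dyadic n k `<=` (I0 : set R).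
Proof.
elim: n k => [|n ih] k kn; first by move: kn; rewrite ltnS leqn0 => /eqP ->; rewrite I0E.
apply: subset_trans (@dyadic_parent n k) (ih _ _).
by rewrite ltn_half_double -mul2n -expnS.
Qed.

Lemma mu_dyadic n k : mu (dyadic n k) = (2 ^- n)%:E.
Proof.
rewrite /dyadic lebesgue_measure_itv /= lte_fin ltr_pM2r ?invr_gt0 ?exprn_gt0//.
rewrite ltr_nat ltnSn -EFinB -mulrBl -natr1; congr EFin.
by rewrite addrAC subrr add0r mul1r.
Qed.

End dyadic_intervals.

Section step_functions.
Context {R : realType} {A : Type}.
Local Notation mu := (@lebesgue_measure R).
Implicit Types (s : tree R A) (h : A -> R) (n k : nat) (x c : R).

Fixpoint value s n k x : A :=
  match s with
  | Leaf a => a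
  | Node _ l r => if x < k.*2.+1%:R / 2 ^+ n.+1 then value l n.+1 k.*2 x
                  else value r n.+1 k.*2.+1 x
  end.

(** Below a leaf, [child] repeats the leaf: every dyadic interval gets a subtree, with zero sign and
    jump there. *)
Fixpoint subtree s n k : tree R A :=
  if n is n'.+1 then child (odd k) (subtree s n' k./2) else s.

Lemma value_half s n k (b : bool) x : dyadic n.+1 (b + k.*2) x ->
  value s n k x = value (child b s) n.+1 (b + k.*2) x.
Proof.
case: s => [//|e l r]; rewrite /dyadic /= in_itv /=.
case: b => /= /andP[x1 x2]; last by rewrite x2.
by rewrite ltNge; move: x1; rewrite add1n => ->.
Qed.

Lemma value_subtree s n k x : (k < 2 ^ n)%N -> dyadic n k x ->
  value s 0 0 x = value (subtree s n k) n k x.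
Proof.
elim: n k => [|n ih] k kn; first by move: kn; rewrite ltnS leqn0 => /eqP ->.
move=> xk; rewrite (ih k./2); last exact: dyadic_parent.
  by rewrite (@value_half _ n k./2 (odd k)) odd_double_half.
by rewrite ltn_half_double -mul2n -expnS.
Qed.

Lemma all_subtrees_subtree (P : tree R A -> Prop) s n k :
  all_subtrees P s -> P (subtree s n k).
Proof.
move=> Ps; apply: all_subtreesW; elim: n k => [//|n ih] k /=.
exact: all_subtrees_child.
Qed.

Lemma subtree_leaf s n k : (depth s <= n)%N -> exists a, subtree s n k = Leaf a.
Proof.
suff H : (depth (subtree s n k) <= depth s - n)%N.
  move=> sn; move: H; move: sn; rewrite -subn_eq0 => /eqP ->.
  by case: subtree => // a _; exists a.
elim: n k => [|n ih] k /=; first by rewrite subn0.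
rewrite subnS; have := ih k./2; case: subtree => [//|e l r] /=.
case: (depth s - n)%N => // m; rewrite ltnS geq_max => /andP[? ?].
by case: ifP.
Qed.

Lemma measurable_halves (F : R -> R) n k :
  measurable_fun (dyadic n.+1 k.*2) F -> measurable_fun (dyadic n.+1 k.*2.+1) F ->
  measurable_fun (dyadic n k) F.
Proof.
move=> mF1 mF2; rewrite dyadic_split.
by apply/measurable_funU => //; exact: measurable_dyadic.
Qed.

Lemma measurable_value h s n k :
  measurable_fun (dyadic n k) (fun x => h (value s n k x)).
Proof.
elim: s n k => [a|e l ihl r ihr] n k; first exact: (@measurable_cst _ _ _ _ _ (h a)).
apply: measurable_halves.
- apply: eq_measurable_fun (ihl n.+1 k.*2) => x /set_mem xk.
  by rewrite (@value_half _ n k false).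
- apply: eq_measurable_fun (ihr n.+1 k.*2.+1) => x /set_mem xk.
  by rewrite (@value_half _ n k true).
Qed.

Lemma avgZ h c s : avg (fun a => c * h a) s = c * avg h s.
Proof. by elim: s => //= e l -> r ->; rewrite mulrA mulrDr. Qed.

Lemma integral_value h s n k :
  (\int[mu]_(x in dyadic n k) (h (value s n k x))%:E = (avg h s * 2 ^- n)%:E)%E.
Proof.
elim: s n k => [a|e l ihl r ihr] n k.
  rewrite (_ : (fun x => _) = cst (h a)%:E)//.
  rewrite integral_cst; last exact: measurable_dyadic.
  by rewrite EFinM; congr (_ * _)%E; exact: mu_dyadic.
rewrite dyadic_split integral_setU; last 4 first.
- exact: measurable_dyadic.
- exact: measurable_dyadic.
- by rewrite -dyadic_split; apply/measurable_EFinP; exact: measurable_value.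
- exact: dyadic_disj.
rewrite -[avg _ _]/((avg h l + avg h r) / 2).
have -> : (avg h l + avg h r) / 2 * 2 ^- n = avg h l * 2 ^- n.+1 + avg h r * 2 ^- n.+1.
  by rewrite exprS invfM -mulrDl mulrA.
rewrite EFinD -(ihl _ k.*2) -(ihr _ k.*2.+1); congr (_ + _)%E.
- by apply: eq_integral => x /set_mem xk; rewrite (@value_half _ n k false).
- by apply: eq_integral => x /set_mem xk; rewrite (@value_half _ n k true).
Qed.

Lemma integrable_value h s n k :
  mu.-integrable (dyadic n k) (EFin \o (fun x => h (value s n k x))).
Proof.
apply/integrableP; split; first by apply/measurable_EFinP; exact: measurable_value.
by rewrite (integral_value (fun a => `|h a|)) ltry.
Qed.

Lemma integral_subtree h s n k : (k < 2 ^ n)%N ->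
  (\int[mu]_(x in dyadic n k) (h (value s 0 0 x))%:E =
   (avg h (subtree s n k) * 2 ^- n)%:E)%E.
Proof.
move=> kn; rewrite -(integral_value _ _ _ k); apply: eq_integral => x /set_mem xk.
by rewrite (value_subtree _ kn).
Qed.

(** * Haar coefficients and martingale transforms of step functions *)

Definition jump h s : R := (avg h (child true s) - avg h (child false s)) / 2.

Lemma haar_coef_value h s n k : (k < 2 ^ n)%N ->
  haar_coef (fun x => h (value s 0 0 x)) n k =
  (Num.sqrt (2 ^- n))^-1 * (jump h (subtree s n k) * 2 ^- n).
Proof.
move=> kn; set q := (Num.sqrt _)^-1; set F := fun x : R => h (value s 0 0 x).
set u := subtree s n k.
have FE (b : bool) x : dyadic n.+1 (b + k.*2) x ->
    F x = h (value (child b u) n.+1 (b + k.*2) x).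
  move=> xb; rewrite /F (value_subtree _ kn) ?(@value_half _ n k b)//.
  exact: dyadic_half xb.
have Fl x : dyadic n.+1 k.*2 x ->
    F x * haar n k x = - q * h (value (child false u) n.+1 k.*2 x).
  move=> xk; rewrite (FE false)// /haar !indicE (mem_set xk) memNset; last first.
    move=> xk'; have /disj_setPS := @dyadic_disj R n k.
    by move=> /(_ x (conj xk xk')).
  by rewrite sub0r mulrC mulrN mulr1.
have Fr x : dyadic n.+1 k.*2.+1 x ->
    F x * haar n k x = q * h (value (child true u) n.+1 k.*2.+1 x).
  move=> xk; rewrite (FE true)// /haar !indicE (mem_set xk) memNset; last first.
    move=> xk'; have /disj_setPS := @dyadic_disj R n k.
    by move=> /(_ x (conj xk' xk)).
  by rewrite subr0 mulrC mulr1.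
have haar0 x : ~ dyadic n k x -> haar n k x = 0.
  rewrite dyadic_split => /not_orP[x1 x2]; rewrite /haar !indicE !memNset//.
  by rewrite subrr mulr0.
have mF : measurable_fun (dyadic n k) (fun x => F x * haar n k x).
  apply: measurable_halves.
  - apply: (eq_measurable_fun (fun x => - q * h (value (child false u) n.+1 k.*2 x))).
      by move=> x /set_mem xk; rewrite Fl.
    exact: (measurable_value (fun a => - q * h a)).
  - apply: (eq_measurable_fun (fun x => q * h (value (child true u) n.+1 k.*2.+1 x))).
      by move=> x /set_mem xk; rewrite Fr.
    exact: (measurable_value (fun a => q * h a)).
rewrite /haar_coef.
have -> : \int[mu]_(x in I0) (F x * haar n k x) =
          \int[mu]_(x in dyadic n k) (F x * haar n k x).
  rewrite -(setIidr (dyadic_sub_I0 kn)) [RHS]Rintegral_mkcondr.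
  apply: eq_Rintegral => x _; rewrite patchE; case: ifPn => // /negP xk.
  by rewrite haar0 ?mulr0// => xk'; apply: xk; exact: mem_set.
rewrite /Rintegral dyadic_split integral_setU; last 4 first.
- exact: measurable_dyadic.
- exact: measurable_dyadic.
- by rewrite -dyadic_split; exact/measurable_EFinP.
- exact: dyadic_disj.
under eq_integral => x /set_mem xk do rewrite Fl//.
rewrite (integral_value (fun a => - q * h a)) avgZ.
under eq_integral => x /set_mem xk do rewrite Fr//.
rewrite (integral_value (fun a => q * h a)) avgZ /= /jump exprS.
by field; rewrite expf_neq0// pnatr_eq0.
Qed.

(** Only the interval of generation [n] containing [x] contributes, with a sign given by the parity
    of [k]. The two normalizing factors cancel the length [2 ^- n]. *)
Lemma sum_haar (eps : forall n, 'I_(2 ^ n) -> R) h s n k x : (k < 2 ^ n.+1)%N ->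
  dyadic n.+1 k x -> forall kn : (k./2 < 2 ^ n)%N,
  \sum_(i < 2 ^ n) eps n i * haar_coef (fun y => h (value s 0 0 y)) n i * haar n i x
  = (-1) ^+ (~~ odd k) * (eps n (Ordinal kn) * jump h (subtree s n k./2)).
Proof.
move=> kn1 xk kn; rewrite (bigD1 (Ordinal kn))//= big1 ?addr0 => [|i ik].
  rewrite haar_coef_value// /haar !indicE.
  have in_ m : (x \in dyadic n.+1 m) = (k == m).
    apply/idP/eqP => [/set_mem xm|<-]; last exact: mem_set.
    exact: dyadic_inj xk xm.
  have -> : (x \in dyadic n.+1 k./2.*2.+1) = odd k.
    by rewrite in_ -{1}(odd_double_half k) -add1n eqn_add2r; case: odd.
  have -> : (x \in dyadic n.+1 k./2.*2) = ~~ odd k.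
    rewrite in_ -{1}(odd_double_half k) -[X in _ == X]add0n eqn_add2r.
    by case: odd.
  have p0 : 0 < 2 ^- n :> R by rewrite invr_gt0 exprn_gt0.
  have : Num.sqrt (2 ^- n) ^+ 2 = 2 ^- n :> R by rewrite sqr_sqrtr// ltW.
  have : Num.sqrt (2 ^- n) != 0 :> R by rewrite gt_eqF// sqrtr_gt0.
  move: (Num.sqrt _) => q q0 <-.
  by case: (odd k); rewrite /= ?expr0 ?expr1; field.
rewrite /haar !indicE !memNset ?subrr ?mulr0// => xi; move/eqP: ik; apply;
  apply: val_inj => /=; rewrite (dyadic_inj xk xi) ?doubleK//.
exact/esym/(half_bit_double i true).
Qed.

Fixpoint partial_transform h s n k : R :=
  if n is n'.+1 then
    partial_transform h s n' k./2 +
    (-1) ^+ (~~ odd k) * (sign (subtree s n' k./2) * jump h (subtree s n' k./2))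
  else 0.

End step_functions.

Lemma child_transform (R : realType) (A : Type) (h : A -> R) c b (s : tree R A) :
  child b (transform h c s) =
  transform h (c + (-1) ^+ (~~ b) * (sign s * jump h s)) (child b s).
Proof.
case: s => [a|e l r] /=; first by rewrite mul0r mulr0 addr0.
by case: b; rewrite /jump /= ?expr0 ?expr1 ?mul1r ?mulN1r.
Qed.

(** The accumulator of [transform] at a node is the partial sum of the Haar series over the coarser
    generations. *)
Lemma subtree_transform (R : realType) (A : Type) (h : A -> R) (s : tree R A) n k :
  subtree (transform h 0 s) n k =
  transform h (partial_transform h s n k) (subtree s n k).
Proof. by elim: n k => [//|n ih] k /=; rewrite ih child_transform. Qed.

(** From generation [depth s] on all subtrees are leaves, so the partial sums are stationary. *)
Lemma haar_multiplier_value (R : realType) (A : Type) (h : A -> R) (s : tree R A) x :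
  I0 x ->
  haar_multiplier (fun n k => sign (subtree s n k)) (fun y => h (value s 0 0 y)) x =
  (value (transform h 0 s) 0 0 x).2.
Proof.
move=> x0; apply: lim_near_cst => //.
exists (depth s) => // N /= sN; have [k kN xk] := dyadic_cover N x0.
rewrite (value_subtree _ kN xk) subtree_transform.
have [a ->] := subtree_leaf k sN; rewrite /=.
elim: N k kN xk {sN} => [|N ih] k kN xk; first by rewrite big_ord0.
have kN' : (k./2 < 2 ^ N)%N by rewrite ltn_half_double -mul2n -expnS.
rewrite big_ord_recr /= (ih _ kN' (dyadic_parent xk)).
by rewrite (sum_haar (fun n k => sign (subtree s n k)) h s kN xk kN').
Qed.

(** * A_1 constants and weak-type bounds read off a tree *)

Section step_weights.
Context {R : realType}.
Local Notation mu := (@lebesgue_measure R).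
Implicit Types (s : tree R (R * R)) (K : R).

Definition weight_of s : R -> R := fun x => (value s 0 0 x).1.
Definition fun_of s : R -> R := fun x => (value s 0 0 x).2.
Definition transform_of s : (R -> R) -> R -> R :=
  haar_multiplier (fun n k => sign (subtree s n k)).

Lemma value_all_leaves (P : R * R -> Prop) s n k x :
  all_leaves P s -> P (value s n k x).
Proof.
elim: s n k => [//|e l ihl r ihr] n k /= [Pl Pr].
by case: ifP => _; [exact: ihl|exact: ihr].
Qed.

Lemma average_weight_of s n k : (k < 2 ^ n)%N ->
  average (weight_of s) (dyadic n k) = (avg fst (subtree s n k))%:E.
Proof.
move=> kn; rewrite /average (integral_subtree fst)// mu_dyadic.
have p0 : 2 ^- n != 0 :> R by rewrite invr_eq0 expf_neq0// pnatr_eq0.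
by rewrite inver (negbTE p0) -EFinM mulfK.
Qed.

Lemma ess_inf_weight_of_ge s n k (mJ : measurable (dyadic n k : set R)) m :
  (k < 2 ^ n)%N -> all_leaves (fun a : R * R => m <= a.1) (subtree s n k) ->
  (m%:E <= ess_inf_on mJ (weight_of s))%E.
Proof.
(* The complement of the interval is null for the restricted measure and serves as exceptional
   set. *)
move=> kn ms; apply/ess_infP; exists (~` dyadic n k); split.
- exact: measurableC.
- by rewrite -[LHS]/(mu (~` dyadic n k `&` dyadic n k)) setICl measure0.
- move=> x /= xm xk; apply: xm; rewrite lee_fin /weight_of (value_subtree _ kn xk).
  exact: (@value_all_leaves (fun a => m <= a.1)).
Qed.

(** The right half of the unit interval has positive measure and carries the constant weight
    [a.1]. *)
Lemma ess_inf_weight_of_le s (mJ : measurable (dyadic 0 0 : set R)) a :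
  subtree s 1 1 = Leaf a -> (ess_inf_on mJ (weight_of s) <= a.1%:E)%E.
Proof.
move=> sa; have [N [mN N0 sN]] := ess_inf_le (mrestr mu mJ) (EFin \o weight_of s).
have sub1 : dyadic 1 1 `<=` (dyadic 0 0 : set R) by exact: (@dyadic_parent _ 0 1).
rewrite leNgt; apply/negP => lta.
have : (mu (dyadic 1 1) <= mu (N `&` dyadic 0 0))%E.
  apply: le_measure; rewrite ?inE; first exact: measurable_dyadic.
    exact: measurableI.
  move=> x x1; split; last exact: sub1.
  apply: sN => /= /(lt_le_trans lta).
  by rewrite /weight_of (value_subtree _ _ x1)// sa ltxx.
rewrite (_ : mu (N `&` dyadic 0 0) = 0%E)//.
rewrite mu_dyadic lee_fin expr1.
by rewrite invr_le0 lern0.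
Qed.

Lemma A1_char_weight_of_le s K :
  all_subtrees (A1_node K) s -> (A1_char (weight_of s) <= K%:E)%E.
Proof.
move=> sK; apply: ge_ereal_sup => _ [J [DJ ->]].
move: (Dyadic_measurable DJ); case: DJ => n [k [kn ->]] mJ.
have [m [m0 lm avgK]] := all_subtrees_subtree n k sK.
have := ess_inf_weight_of_ge mJ kn lm; rewrite average_weight_of//.
have avg0 : 0 <= avg fst (subtree s n k).
  elim: (subtree _ _ _) lm => [a /=|e l ihl r ihr /= [/ihl ? /ihr ?]].
    exact/le_trans/ltW.
  by rewrite divr_ge0// addr_ge0.
case: (ess_inf_on _ _) => [y| |] //; last first.
  (* An infinite essential infimum has inverse 0; only [0 <= K] remains. *)
  by rewrite invey mule0 => _; rewrite lee_fin -(pmulr_lge0 _ m0) (le_trans avg0).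
rewrite lee_fin => my; have y0 := lt_le_trans m0 my.
rewrite inver gt_eqF// -EFinM lee_fin ler_pdivrMr// (le_trans avgK)//.
by rewrite ler_wpM2l// -(pmulr_lge0 _ m0) (le_trans avg0).
Qed.

Lemma A1_char_weight_of_ge s m a : 0 < m ->
  all_leaves (fun b : R * R => m <= b.1) s -> subtree s 1 1 = Leaf a ->
  ((avg fst s / a.1)%:E <= A1_char (weight_of s))%E.
Proof.
move=> m0 ms sa.
have D0 : Dyadic (dyadic 0 0 : set R) by exists 0%N, 0%N.
apply: (@le_trans _ _ (average (weight_of s) (dyadic 0 0) *
  (ess_inf_on (Dyadic_measurable D0) (weight_of s))^-1)%E); last first.
  by apply: ereal_sup_ubound; exists (dyadic 0 0), D0.
rewrite average_weight_of//=.
have avg0 : 0 <= avg fst s.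
  elim: s ms {sa} => [b /=|e l ihl r ihr /= [/ihl ? /ihr ?]].
    exact/le_trans/ltW.
  by rewrite divr_ge0// addr_ge0.
have := ess_inf_weight_of_le (Dyadic_measurable D0) sa.
have := @ess_inf_weight_of_ge s _ _ (Dyadic_measurable D0) m (isT : (0 < 2 ^ 0)%N) ms.
case: (ess_inf_on _ _) => [y| |] //; rewrite !lee_fin => my ya.
have y0 := lt_le_trans m0 my.
by rewrite inver gt_eqF// -EFinM lee_fin ler_wpM2l// lef_pV2// posrE (lt_le_trans y0).
Qed.

Lemma A1_weight_of s m K : 0 < m -> all_leaves (fun a : R * R => m <= a.1) s ->
  all_subtrees (A1_node K) s -> A1 (weight_of s).
Proof.
move=> m0 ms sK; split; last by rewrite (le_lt_trans (A1_char_weight_of_le sK))// ltry.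
split; first by rewrite I0E; exact: (integrable_value fst).
apply: nearW => x _; apply: lt_le_trans m0 _.
exact: (@value_all_leaves (fun a => m <= a.1)).
Qed.

Lemma martingale_transform_of s :
  all_subtrees (fun u => `|sign u| <= 1) s -> martingale_transform (transform_of s).
Proof.
move=> ss; exists (fun n k => sign (subtree s n k)) => // n k.
exact: (@all_subtrees_subtree _ _ (fun u => `|sign u| <= 1)).
Qed.

Lemma value_transform h c s n k x :
  (value (transform h c s) n k x).1 = value s n k x.
Proof. by elim: s n k c => //= e l ihl r ihr n k c; case: ifP. Qed.

(** Testing the weak-type inequality on [fun_of s] reduces it to finite averages over the tree. *)
Lemma weak_type_boundW s (alpha N : R) : 0 < alpha ->
  weak_type_bound (weight_of s) (transform_of s) N ->
  alpha * avg (fun l : (R * R) * R => l.1.1 * (alpha < `|l.2|)%R%:R) (transform snd 0 s)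
  <= N * avg (fun a : R * R => `|a.2| * a.1) s.
Proof.
move=> a0 /(_ alpha (fun_of s) a0).
rewrite I0E (integral_value (fun a : R * R => `|a.2| * a.1)) expr0 invr1 mulr1.
have fL1 : L1 (weight_of s) (fun_of s).
  split; rewrite I0E; first exact: measurable_value.
  by rewrite (integral_value (fun a : R * R => `|a.2| * a.1)) ltry.
move=> /(_ fL1); rewrite -EFinM.
suff -> : wmeasure (weight_of s)
    [set x | dyadic 0 0 x /\ alpha < `|transform_of s (fun_of s) x|] =
  (avg (fun l : (R * R) * R => l.1.1 * (alpha < `|l.2|)%R%:R) (transform snd 0 s))%:E.
  by rewrite -EFinM lee_fin.
rewrite -[RHS]/((fun r : R => r%:E) _) -[avg _ _]mulr1 -[X in _ * X]invr1 -(expr0 2).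
rewrite -(integral_value _ _ _ 0) /wmeasure -[[set x | _]]/(dyadic 0 0 `&` [set x | _]).
rewrite integral_mkcondr; apply: eq_integral => x /set_mem x0.
rewrite patchE /transform_of /fun_of.
have Tx : haar_multiplier (fun n k => sign (subtree s n k))
    (fun y => (value s 0 0 y).2) x = (value (transform snd 0 s) 0 0 x).2.
  by rewrite haar_multiplier_value// I0E.
rewrite value_transform -Tx; case: ifPn => [/set_mem /= ->|/negP xP].
  by rewrite mulr1.
have -> : (alpha < `|haar_multiplier (fun n k => sign (subtree s n k))
    (fun y => (value s 0 0 y).2) x|) = false.
  by apply/negP => xP'; apply: xP; exact: mem_set.
by rewrite mulr0.
Qed.

End step_weights.

(** * Choice of the parameters *)

Section parameters.
Context {R : realType} (j : nat).

(** Here [n = 4 ^ M / 2], and [M >= 8] makes the total mean gain at least 4, against a total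
    variance of at most 2. *)
Let M := (j + 8)%N.
Let n := (2 * 4 ^ (j + 7))%N.
Let t : R := 4 ^+ M.
Let p : R := 4 ^- M.
Definition extremal_tree : tree R (R * R) := gen M n 1.
Local Notation s := extremal_tree.

Let t_gt0 : 0 < t. Proof. exact: pow4_gt0. Qed.
Let p_gt0 : 0 < p. Proof. by rewrite invr_gt0. Qed.
Let pt : p * t = 1. Proof. by rewrite mulVf// gt_eqF. Qed.

Let np : n%:R * p = 1 / 2.
Proof.
rewrite /p /n /M natrM natrX (addnS j 7) exprS invfM.
have : (4 ^+ (j + 7) : R) != 0 by rewrite expf_neq0// pnatr_eq0.
by move=> ?; field.
Qed.

Let M_ge8 : 8 <= M%:R :> R. Proof. by rewrite ler_nat leq_addl. Qed.

Let M_le_t : M%:R <= t. Proof. by rewrite /t -natrX ler_nat ltnW// ltn_expl. Qed.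

Let n_le_t : n%:R <= t.
Proof. by rewrite -(ler_pM2r p_gt0) np [t * p]mulrC pt; lra. Qed.

Let p_le : p <= 1 / 8.
Proof. by rewrite -(ler_pM2r t_gt0) pt; have := M_ge8; have := M_le_t; lra. Qed.

(** The next generation receives a fraction [1 - p] of the scale, and [n * p = 1 / 2]. *)
Let mass : 1 / 2 <= (3 * mom0 M) ^+ n :> R.
Proof.
have -> : 3 * mom0 M = 1 - p :> R by rewrite /mom0 -/p; field.
apply: le_trans (bernoulli_inequality _ _).
  by rewrite np; lra.
by rewrite ltW//=; have := p_le; lra.
Qed.

Let mom0_bounds : 1 / 4 <= (mom0 M : R) <= 1 / 3.
Proof. by rewrite /mom0 -/p; have := p_le; have := p_gt0; lra. Qed.

Let mean_ge : M%:R * p <= gain_mean M :> R.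
Proof.
have /andP[m1 m2] := mom0_bounds; have m0 : 0 < mom0 M :> R by lra.
rewrite /gain_mean ler_pdivlMr// /mom1 -/p.
have : M%:R * p * mom0 M <= M%:R * p * (1 / 3).
  by rewrite ler_wpM2l// mulr_ge0// ltW.
have : 0 <= p * mom0 M by rewrite mulr_ge0// ltW.
lra.
Qed.

Let variance_le : n%:R * gain_variance M <= 2 :> R.
Proof.
have /andP[m1 m2] := mom0_bounds; have m0 : 0 < mom0 M :> R by lra.
have : gain_variance M <= 4 * p :> R.
  rewrite /gain_variance; apply: (@le_trans _ _ (mom2 M / mom0 M)).
    by rewrite gerBl sqr_ge0.
  rewrite ler_pdivrMr//; apply: (@le_trans _ _ p); last first.
    by have := ler_wpM2l (ltW p_gt0) m1; lra.
  rewrite /mom2 -/p -/t.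
  have : p ^+ 2 / 9 * ((t * 4 - 4) / 3 + 4 * M%:R + 4 * mom0 M) <= p ^+ 2 / 9 * (9 * t).
    rewrite ler_wpM2l//; first by rewrite divr_ge0// sqr_ge0.
    by have := M_le_t; have := t_gt0; lra.
  move/le_trans; apply.
  have -> : p ^+ 2 / 9 * (9 * t) = p * (p * t) by field.
  by rewrite pt mulr1.
by move/(ler_wpM2l (ler0n R n)); have := np; lra.
Qed.

Lemma A1_extremal : A1 (weight_of s).
Proof.
apply: (@A1_weight_of _ _ (1 / t) (6 * t)); first by rewrite divr_gt0.
  exact: all_leaves_gen.
exact: A1_gen.
Qed.

Lemma A1_char_extremal_le : (A1_char (weight_of s) <= (6 * 4 ^+ (j + 8))%:E)%E.
Proof.
by apply: A1_char_weight_of_le; apply: A1_gen.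
Qed.

Lemma A1_char_extremal_ge : ((4 ^+ (j + 8) / 2)%:E <= A1_char (weight_of s))%E.
Proof.
have [z sz] : exists z, subtree s 1 1 = Leaf (1 / t, z).
  have : (0 < n)%N by rewrite muln_gt0 expn_gt0.
  rewrite /extremal_tree; case: n => // n' _.
  by exists (- 2 / t); rewrite /t /M (addnS j 7).
apply: le_trans (A1_char_weight_of_ge (m := 1 / t) _ _ sz); last 2 first.
- by rewrite divr_gt0.
- exact: all_leaves_gen.
rewrite lee_fin /= div1r invrK -/t mulrC ler_wpM2r ?(ltW t_gt0)//.
apply: (@le_trans _ _ ((3 * mom0 M) ^+ n)); first by have := mass; lra.
(* With [phi = 1] and [kappa = 0] the Chebyshev estimate is a lower bound for the total mass. *)
have := @avg_transform_gen R M (fun=> 1) (fun=> ler01) n 1 0 0 0.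
rewrite addn_gt0 orbT => /(_ isT ler01).
rewrite !mul0r subr0 mulr1 mul1r; under eq_fun do rewrite mulr1.
rewrite (avg_transform _ fst); apply => a.
by rewrite mul0r subr0.
Qed.

Lemma weak_norm_extremal :
  (((j + 8)%:R * 4 ^+ (j + 8) / 16)%:E <= weak_norm (weight_of s) (transform_of s))%E.
Proof.
apply/ereal_infP => _ [N wN <-]; rewrite lee_fin -/M -/t.
pose m : R := n%:R * gain_mean M.
have mM : M%:R / 2 <= m.
  have := ler_wpM2l (ler0n R n) mean_ge.
  by rewrite mulrCA np /m; lra.
have m0 : 0 < m by have := M_ge8; lra.
have alpha0 : 0 < m / 2 by rewrite divr_gt0.
have := weak_type_boundW alpha0 wN.
(* The threshold is half the mean: [|a| <= m / 2] forces [|a - m| >= m / 2], so the parabola with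
   [kappa = 4 / m ^+ 2] is nonpositive there. *)
pose phi (a : R) : R := (m / 2 < `|a|)%R%:R.
have phi0 a : 0 <= phi a by rewrite /phi ler0n.
have phi_ge a : 1 - 4 / m ^+ 2 * (a - m) ^+ 2 <= phi a.
  rewrite /phi; case: ltP => [_|am].
    by rewrite gerBl mulr_ge0// ?sqr_ge0// divr_ge0// sqr_ge0.
  rewrite subr_le0 mulrAC ler_pdivlMr ?exprn_gt0// mul1r.
  move: am; rewrite ler_norml => /andP[? ?]; nra.
have M0 : (0 < M)%N by rewrite addn_gt0 orbT.
have := avg_transform_gen phi0 n 0 M0 ler01 phi_ge.
rewrite add0r -/m subrr expr0n add0r mul1r -/s -/phi.
set E := avg _ _ => E1.
have E4 : 1 / 4 <= E.
  have v2 : 4 / m ^+ 2 * (n%:R * gain_variance M) <= 1 / 2.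
    rewrite mulrAC ler_pdivrMr ?exprn_gt0//.
    by have := variance_le; have := M_ge8; nra.
  have : 1 / 2 * (1 / 2) <=
      (3 * mom0 M) ^+ n * (1 - 4 / m ^+ 2 * (n%:R * gain_variance M)).
    by apply: ler_pM; rewrite ?divr_ge0//; lra.
  lra.
have := @avg_cost_gen R M n 1 ler01; rewrite -/s -/t.
have c0 : 0 <= avg (fun a : R * R => `|a.2| * a.1) s.
  have := @all_leaves_gen R M n 1 ler01; rewrite -/s.
  elim: s => [a /= a1|e l ihl r ihr /= [/ihl ? /ihr ?]].
    by rewrite mulr_ge0// (le_trans _ a1)// divr_ge0// ltW.
  by rewrite divr_ge0// addr_ge0.
have -> : 2 * n%:R * 1 / t ^+ 2 = p.
  have -> : 2 * n%:R * 1 / t ^+ 2 = 2 * (n%:R * p) * p.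
    by rewrite /p -/t; field; rewrite gt_eqF.
  by rewrite np; field.
move=> cp aN.
have aN' : M%:R / 16 <= N * avg (fun a : R * R => `|a.2| * a.1) s.
  by apply: le_trans aN; nra.
(* The product in [aN'] is positive and the cost is nonnegative. *)
have N0 : 0 <= N.
  by rewrite leNgt; apply/negP => N0; have := M_ge8; nra.
have := ler_wpM2l N0 cp => Np.
rewrite -(ler_pM2r p_gt0); apply: le_trans Np; apply: le_trans aN'.
have -> : M%:R * t / 16 * p = M%:R / 16 * (p * t) by field.
by rewrite pt mulr1.
Qed.

End parameters.

Theorem theorem3p2 (R : realType) :
  exists c : R, 0 < c /\
  exists (w : nat -> R -> R) (T : nat -> (R -> R) -> (R -> R)),
    [/\ forall j, A1 (w j),
        A1_char (w j) @[j --> \oo] --> +oo%E,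
        forall j, martingale_transform (T j) &
        forall j, ((c * fine (A1_char (w j)) * ln (fine (A1_char (w j))))%:E
                   <= weak_norm (w j) (T j))%E].
Proof.
(* With [a] the A_1 constant, [a <= 6 * t] and [ln a <= 6 * M] give [a * ln a <= 36 * M * t], and
   [36 / 1000 <= 1 / 16]. *)
exists (1 / 1000); split; first by lra.
exists (fun j => weight_of (extremal_tree j)), (fun j => transform_of (extremal_tree j)).
have exp_ge (j : nat) : j%:R <= 4 ^+ (j + 8) / 2 :> R.
  rewrite ler_pdivlMr// addnS -natrX -natrM ler_nat expnSr leq_mul//.
  by apply: leq_trans (leq_addr 7 j) (ltnW _); exact: ltn_expl.
split.
- by move=> j; exact: A1_extremal.
- apply/cvgeyPge => A; near=> j.
  apply: le_trans (A1_char_extremal_ge j); rewrite lee_fin.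
  by apply: le_trans (exp_ge j); near: j; exact: nbhs_infty_ger.
- by move=> j; apply: martingale_transform_of; exact: sign_gen.
- move=> j; apply: le_trans (weak_norm_extremal j).
  have := @A1_char_extremal_le R j; have := @A1_char_extremal_ge R j.
  case: (A1_char _) => [a| |] //=; rewrite !lee_fin => a1 a2.
  set t : R := 4 ^+ (j + 8) in a1 a2 *; set M : R := (j + 8)%:R.
  have t2 : 2 <= t.
    rewrite /t addnS exprS; have : 1 <= 4 ^+ (j + 7) :> R by rewrite exprn_ege1// ler1n.
    lra.
  have M8 : 8 <= M by rewrite ler_nat leq_addl.
  have a_ge1 : 1 <= a by lra.
  have ln4 : ln 4 <= 3 :> R.
    have -> : 4 = 1 + 3 :> R by ring.
    by apply: le_ln1Dx; lra.
  have lna : ln a <= 6 * M.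
    (* The factor 6 is absorbed in [4 ^+ 2]. *)
    apply: (@le_trans _ _ (ln (4 ^+ (j + 8 + 2)))).
      rewrite ler_ln ?posrE//; last lra.
      by apply: le_trans a2 _; rewrite exprD -/t expr2; lra.
    by rewrite lnXn// -[ln 4 *+ _]mulr_natr natrD -/M; nra.
  have ln0 : 0 <= ln a by exact: ln_ge0.
  have : a * ln a <= 6 * t * (6 * M) by apply: ler_pM => //; lra.
  have : 0 <= M * t by rewrite mulr_ge0//; lra.
  lra.
Unshelve. all: by end_near.
Qed.
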